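(* Let $X$ be a paracompact Hausdorff space. Then the following assertions are equivalent: (1) $X$ is Scheepers; (2) $X$ is strongly star-Scheepers; (3) $X$ is star-$K$-Scheepers; (4) $X$ is star-Scheepers.
   Context: For a subset $A$ of a topological space $X$ and a collection $\mathcal{P}$ of subsets of $X$, $St(A,\mathcal{P})=\bigcup\{B\in\mathcal{P}: A\cap B\neq\emptyset\}$. An open cover $\mathcal{U}$ of $X$ is an $\omega$-cover if for each finite $F\subseteq X$ there is $U\in\mathcal{U}$ with $F\subseteq U$ (the set $X$ itself is allowed to be a member). $X$ is Scheepers if for each sequence $(\mathcal{U}_n)_{n\in\mathbb{N}}$ of open covers of $X$ there are finite $\mathcal{V}_n\subseteq\mathcal{U}_n$ ($n\in\mathbb{N}$) such that $\{\bigcup\mathcal{V}_n: n\in\mathbb{N}\}$ is an $\omega$-cover of $X$ or $\bigcup\mathcal{V}_n=X$ for some $n$. $X$ is star-Scheepers if for each sequence $(\mathcal{U}_n)_{n\in\mathbb{N}}$ of open covers of $X$ there are finite $\mathcal{V}_n\subseteq\mathcal{U}_n$ ($n\in\mathbb{N}$) such that $\{St(\bigcup\mathcal{V}_n,\mathcal{U}_n): n\in\mathbb{N}\}$ is an $\omega$-cover of $X$ or $St(\bigcup\mathcal{V}_n,\mathcal{U}_n)=X$ for some $n$. $X$ is strongly star-Scheepers (resp. star-$K$-Scheepers) if for each sequence $(\mathcal{U}_n)_{n\in\mathbb{N}}$ of open covers of $X$ there is a sequence $(K_n)_{n\in\mathbb{N}}$ of finite (resp. compact) subsets of $X$ such that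 $\{St(K_n,\mathcal{U}_n): n\in\mathbb{N}\}$ is an $\omega$-cover of $X$. *)

(* Defs.v *)
From mathcomp Require Import all_boot all_order all_classical.
From mathcomp Require Import topology.

Set Implicit Arguments.
Unset Strict Implicit.
Unset Printing Implicit Defensive.

Local Open Scope classical_set_scope.

Section covers.
Context {X : topologicalType}.
Implicit Types (A : set X) (P U V : set (set X)).

Definition star A P : set X :=
  \bigcup_(B in [set B | P B /\ A `&` B !=set0]) B.

Definition open_cover U :=
  U `<=` open /\ \bigcup_(B in U) B = [set: X].

(* [set: X] is allowed to belong to U. *)
Definition omega_cover U :=
  open_cover U /\
  forall F : set X, finite_set F -> exists2 B, U B & F `<=` B.

Definition refines V U := forall B, V B -> exists2 C, U C & B `<=` C.

Definition locally_finite V :=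
  forall x : X, exists2 W, nbhs x W & finite_set [set B | V B /\ W `&` B !=set0].

End covers.

(* Separation is not part of the definition. *)
Definition paracompact (X : topologicalType) :=
  forall U : set (set X), open_cover U ->
    exists V : set (set X), [/\ open_cover V, refines V U & locally_finite V].

Definition scheepers (X : topologicalType) :=
  forall U : nat -> set (set X), (forall n, open_cover (U n)) ->
    exists V : nat -> set (set X),
      (forall n, finite_set (V n) /\ V n `<=` U n) /\
      (omega_cover (range (fun n => \bigcup_(B in V n) B)) \/
       exists n, \bigcup_(B in V n) B = [set: X]).

Definition star_scheepers (X : topologicalType) :=
  forall U : nat -> set (set X), (forall n, open_cover (U n)) ->
    exists V : nat -> set (set X),
      (forall n, finite_set (V n) /\ V n `<=` U n) /\
      (omega_cover (range (fun n => star (\bigcup_(B in V n) B) (U n))) \/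
       exists n, star (\bigcup_(B in V n) B) (U n) = [set: X]).

Definition strongly_star_scheepers (X : topologicalType) :=
  forall U : nat -> set (set X), (forall n, open_cover (U n)) ->
    exists K : nat -> set X,
      (forall n, finite_set (K n)) /\
      omega_cover (range (fun n => star (K n) (U n))).

Definition star_K_scheepers (X : topologicalType) :=
  forall U : nat -> set (set X), (forall n, open_cover (U n)) ->
    exists K : nat -> set X,
      (forall n, compact (K n)) /\
      omega_cover (range (fun n => star (K n) (U n))).

(* Main.v *)
Require Import Defs.
From HB Require Import structures.
From mathcomp Require Import all_boot all_order finmap all_classical.
From mathcomp Require Import topology.

(** (1) => (2) => (3) => (4) hold in every space: a finite family [V n] is
    traced by one point in each of its members, and a compact [K n] is covered
    by finitely many members of [U n].  For (4) => (1), paracompactness and the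
    Hausdorff property provide open covers [W n] such that the star of each
    member of [W n] lies in a member of [U n]; a star-Scheepers selection from
    [W n] then gives a Scheepers selection from [U n].  Such a [W n] is obtained
    by applying twice the fact that an open cover has an open refinement in
    which the star of every point lies in a member of the cover. *)

Set Implicit Arguments.
Unset Strict Implicit.
Unset Printing Implicit Defensive.

Local Open Scope classical_set_scope.

(** * Stars, omega-covers and finite selections in an arbitrary space *)

Section omega_covers.
Context {X : topologicalType}.
Implicit Types (A K : set X) (U V : set (set X)).

Lemma star_open A U : open_cover U -> open (star A U).
Proof. by move=> [Uo _]; apply: bigcup_open => B [UB _]; exact: Uo. Qed.

Lemma star_subl A A' U : A `<=` A' -> star A U `<=` star A' U.
Proof.
move=> AA' y [B [UB [z [Az Bz]]] By]; exists B => //.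
by split=> //; exists z; split=> //; exact: AA'.
Qed.

Lemma open_cover_bigcup_sub U V :
  open_cover U -> V `<=` U -> open (\bigcup_(B in V) B).
Proof. by move=> [Uo _] VU; apply: bigcup_open => B /VU /Uo. Qed.

Lemma omega_cover_range (A : nat -> set X) : (forall n, open (A n)) ->
  (forall F, finite_set F -> exists n, F `<=` A n) -> omega_cover (range A).
Proof.
move=> Ao AF; split; last first.
  by move=> F /AF [n FAn]; exists (A n) => //; exists n.
split; first by move=> _ [n _ <-]; exact: Ao.
apply/seteqP; split=> // x _.
have [n xAn] := AF _ (finite_set1 x).
by exists (A n); [exists n | exact: xAn].
Qed.

(** Merges the two alternatives of the selection principles: an index with [A n] full serves every
    finite [F]. *)
Lemma omega_cover_range_or_full (A : nat -> set X) :
  omega_cover (range A) \/ (exists n, A n = [set: X]) ->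
  forall F, finite_set F -> exists n, F `<=` A n.
Proof.
case=> [[_ AF] F /AF [_ [n _ <-] FA]|[n AnT] F _]; first by exists n.
by exists n; rewrite AnT.
Qed.

Lemma finite_trace V : finite_set V ->
  exists2 K, finite_set K & forall B, V B -> B !=set0 -> B `&` K !=set0.
Proof.
move=> finV.
(* [x0] is only the default value of the choice function at the empty set; in an empty space no
   member is nonempty. *)
have [[x0]|X0] := pselect (exists x : X, True); last first.
  by exists set0 => // B _ [x]; case: X0; exists x.
have /choice[f fP] : forall B : set X, exists x, B !=set0 -> B x.
  by move=> B; have [[x Bx]|B0] := pselect (B !=set0); [exists x|exists x0].
exists (f @` V); first exact: finite_image.
by move=> B VB B0; exists (f B); split; [exact: fP|exists B].
Qed.

Lemma compact_finite_subfamily K U : compact K -> open_cover U ->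
  exists2 V, finite_set V /\ V `<=` U & K `<=` \bigcup_(B in V) B.
Proof.
move=> cK [Uo UT].
have [[x _]|K0] := pselect (K !=set0); last first.
  exists set0; first by split=> //; exact: finite_set0.
  by move=> x Kx; case: K0; exists x.
(* [compact_cover] concerns pointed spaces, so a point of [K] becomes the base point; empty [K] was
   treated apart. *)
pose Y : ptopologicalType := HB.pack X (isPointed.Build X x).
have cKY : compact (K : set Y) by [].
rewrite compact_cover in cKY.
have [||D DU KD] := cKY _ U id.
- exact: Uo.
- by rewrite /cover UT.
exists [set` D] => //; split=> // B /= /DU.
by rewrite inE.
Qed.

End omega_covers.

(** * Locally finite families *)

Section locally_finite.
Context {X : topologicalType}.
Implicit Types (U V : set (set X)).

Lemma locally_finite_sub V V' :
  V' `<=` V -> locally_finite V -> locally_finite V'.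
Proof.
move=> V'V Vlf x; have [W Wx Wfin] := Vlf x; exists W => //.
by apply: sub_finite_set Wfin => B [/V'V VB WB].
Qed.

(** An open set that meets [closure B] already meets [B], so the interior of a witness for [V] is a
    witness for the closures. *)
Lemma locally_finite_closure V :
  locally_finite V -> locally_finite (closure @` V).
Proof.
move=> Vlf x; have [W Wx Wfin] := Vlf x.
exists W^°; first exact: nbhs_interior.
apply: sub_finite_set (finite_image closure Wfin) => _ [[B VB <-] [y [Wy By]]].
exists B => //; split=> //; rewrite setIC.
exact: By.
Qed.

(** Near [x] the union agrees with that of the finitely many members meeting [W], and a finite union
    of closed sets is closed. *)
Lemma locally_finite_closed V : V `<=` closed -> locally_finite V ->
  closed (\bigcup_(B in V) B).
Proof.
move=> Vc Vlf x clx; have [W Wx Wfin] := Vlf x.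
have : closed (\bigcup_(B in [set B | V B /\ W `&` B !=set0]) B).
  by apply: closed_bigcup => // B [/Vc].
move=> /(_ x) []; last by move=> B [VB _] Bx; exists B.
move=> N Nx; have [y [[B VB By] [Wy Ny]]] := clx _ (filterI Wx Nx).
by exists y; split=> //; exists B => //; split=> //; exists y.
Qed.

Lemma locally_finite_at V x : 
  locally_finite V -> finite_set [set B | V B /\ B x].
Proof.
move=> Vlf; have [W Wx Wfin] := Vlf x.
apply: sub_finite_set Wfin => B [VB Bx]; split=> //.
by exists x; split=> //; exact: nbhs_singleton.
Qed.

End locally_finite.

(** * Star refinements in paracompact Hausdorff spaces *)

Section paracompact_hausdorff.
Context {X : topologicalType}.
Hypotheses (Xp : paracompact X) (Xh : hausdorff_space X).
Implicit Types (U V : set (set X)).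

(** Points outside [U] have open neighbourhoods whose closures miss [x]. These and [U] cover the
    space; in a locally finite refinement, the members not inside [U] have closures missing [x], and
    the union of these closures is closed. Its complement is the required neighbourhood. *)
Lemma paracompact_regular (x : X) (U : set X) : open U -> U x ->
  exists V : set X, [/\ open V, V x & closure V `<=` U].
Proof.
move=> Uo Ux.
pose C := [set G : set X | G = U \/ (open G /\ ~ closure G x)].
have Cc : open_cover C.
  split; first by move=> G [->//|[]].
  apply/seteqP; split=> // y _.
  have [Uy|Uy] := pselect (U y); first by exists U => //; left.
  have xy : x != y by apply/eqP => xy; apply: Uy; rewrite -xy.
  have := Xh; rewrite open_hausdorff => /(_ _ _ xy).
  move=> [[G H] /= [/set_mem Gx /set_mem Hy] [Go Ho /eqP GH]].
  exists H => //; right; split=> // /(_ G (open_nbhs_nbhs (conj Go Gx))).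
  by rewrite setIC GH => -[].
have [P [[Po PT] PC Plf]] := Xp Cc.
pose Q := [set B | P B /\ ~ (B `<=` U)].
have Qlf : locally_finite Q by apply: locally_finite_sub Plf => B [].
exists (~` \bigcup_(B in closure @` Q) B); split.
- apply: closed_openC; apply: locally_finite_closed.
    by move=> _ [B _ <-]; exact: closed_closure.
  exact: locally_finite_closure.
- move=> [_ [B [PB BU] <-] Bx].
  have [G [GU|[_ Gx]] BG] := PC _ PB; first by apply: BU; rewrite -GU.
  by apply: Gx; exact: closureS Bx.
- have Oo : open (\bigcup_(B in Q) B) by apply: bigcup_open => B [/Po].
  (* The complement of the open union of [Q] is closed, and it lies in [U] because every member of
     [P] outside [Q] does. *)
  apply: (@subset_trans _ (~` \bigcup_(B in Q) B)).
    have /closure_id -> := open_closedC Oo.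
    apply: closureS => y yQ [B QB By]; apply: yQ.
    by exists (closure B); [exists B|exact: subset_closure].
  move=> y yQ; apply: contrapT => Uy; apply: yQ.
  have : [set: X] y by [].
  rewrite -PT => -[B PB By]; exists B => //.
  by split=> // /(_ _ By).
Qed.

(** By regularity, the open sets whose closure fits in a member of [U] form a cover; the closures of
    a locally finite refinement of it still refine [U]. *)
Lemma locally_finite_closed_refinement U : open_cover U ->
  exists P, [/\ P `<=` closed, locally_finite P, refines P U &
                \bigcup_(B in P) B = [set: X]].
Proof.
move=> [Uo UT].
pose C := [set V : set X | open V /\ exists2 B, U B & closure V `<=` B].
have Cc : open_cover C.
  split; first by move=> V [].
  apply/seteqP; split=> // x _.
  have : [set: X] x by [].
  rewrite -UT => -[B UB Bx].
  have [V [Vo Vx VB]] := paracompact_regular (Uo _ UB) Bx.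
  by exists V => //; split=> //; exists B.
have [P [[Po PT] PC Plf]] := Xp Cc.
exists (closure @` P); split.
- by move=> _ [B _ <-]; exact: closed_closure.
- exact: locally_finite_closure.
- move=> _ [B PB <-]; have [V [_ [G UG VG]] BV] := PC _ PB.
  by exists G => //; apply: subset_trans VG; exact: closureS.
- apply/seteqP; split=> // x _.
  have : [set: X] x by [].
  rewrite -PT => -[B PB Bx].
  by exists (closure B); [exists B|exact: subset_closure].
Qed.

(* Indexing the refinement by points keeps its members nonempty. *)
Lemma point_star_refinement U : open_cover U ->
  exists W : X -> set X, [/\ forall x, open (W x), forall x, W x x &
    forall y, exists2 C, U C & forall x, W x y -> W x `<=` C].
Proof.
move=> Uc; have [P [Pc Plf PU PT]] := locally_finite_closed_refinement Uc.
have /choice[u uP] : forall B, exists C, P B -> U C /\ B `<=` C.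
  move=> B; have [PB|nPB] := pselect (P B); last by exists set0.
  by have [C UC BC] := PU _ PB; exists C.
(* If [y] lies in both [W x] and [B \in P], then [B x], so [W x `<=` u B]. *)
exists (fun x => (\bigcap_(B in [set B | P B /\ B x]) u B) `&`
                 ~` \bigcup_(B in [set B | P B /\ ~ B x]) B); split.
(* Local finiteness is used twice: only finitely many [B] contain [x], and the union of the closed
   [B] avoiding [x] is closed. *)
- move=> x; apply: openI.
    rewrite -[\bigcap_(_ in _) _]setCK setC_bigcap.
    apply: closed_openC; apply: closed_bigcup.
      exact: locally_finite_at.
    by move=> B [PB _]; apply: open_closedC; apply: Uc.1; have [] := uP _ PB.
  apply: closed_openC; apply: locally_finite_closed; first by move=> B [/Pc].
  by apply: locally_finite_sub Plf => B [].
- move=> x; split; last by move=> [B []].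
  by move=> B [PB Bx]; exact: (uP _ PB).2.
- move=> y; have : [set: X] y by [].
  rewrite -PT => -[B PB By]; exists (u B); first exact: (uP _ PB).1.
  move=> x [_ yB] z [zB _]; apply: zB; split=> //.
  by apply: contrapT => Bx; apply: yB; exists B.
Qed.

Lemma strong_star_refinement U : open_cover U ->
  exists2 W : set (set X), open_cover W &
    forall A, W A -> exists2 C, U C & star A W `<=` C.
Proof.
move=> Uc; have [W1 [W1o W1x W1U]] := point_star_refinement Uc.
have range_cover (W : X -> set X) : (forall x, open (W x)) ->
    (forall x, W x x) -> open_cover (range W).
  move=> Wo Wx; split; first by move=> _ [x _ <-]; exact: Wo.
  by apply/seteqP; split=> // x _; exists (W x) => //; exists x.
have [W2 [W2o W2x W2W1]] := point_star_refinement (range_cover _ W1o W1x).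
exists (range W2); first exact: range_cover.
(* [C] depends on [y] alone. If [W2 x] meets [W2 y] at [w], both lie in a single [W1 v]; it contains
   [y], hence is inside [C]. *)
move=> _ [y _ <-]; have [C UC CP] := W1U y; exists C => //.
move=> z [_ [[x _ <-] [w [W2yw W2xw]]] W2xz].
have [_ [v _ <-] W2v] := W2W1 w.
by apply: (CP v); [exact: (W2v y) | exact: (W2v x)].
Qed.

End paracompact_hausdorff.

(** * The cycle of implications *)

Lemma scheepers_strongly_star (X : topologicalType) :
  scheepers X -> strongly_star_scheepers X.
Proof.
move=> XS U Uc; have [V [VU /omega_cover_range_or_full VF]] := XS U Uc.
have /choice[K KP] : forall n, exists K, finite_set K /\
    forall B, V n B -> B !=set0 -> B `&` K !=set0.
  by move=> n; have [K] := finite_trace (VU n).1; exists K.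
exists K; split; first by move=> n; exact: (KP n).1.
apply: omega_cover_range => [n|F /VF[n FV]]; first exact: star_open.
exists n; apply: subset_trans FV _ => x [B VB Bx]; exists B => //.
split; first exact: (VU n).2.
by rewrite setIC; apply: (KP n).2 => //; exists x.
Qed.

Lemma strongly_star_star_K (X : topologicalType) :
  strongly_star_scheepers X -> star_K_scheepers X.
Proof.
move=> XS U /XS [K [Kfin Kom]]; exists K; split=> // n.
exact: finite_compact.
Qed.

Lemma star_K_star_scheepers (X : topologicalType) :
  star_K_scheepers X -> star_scheepers X.
Proof.
move=> XS U Uc; have [K [Kc Kom]] := XS U Uc.
have /choice[V VP] : forall n, exists V, (finite_set V /\ V `<=` U n) /\
    K n `<=` \bigcup_(B in V) B.
  by move=> n; have [V] := compact_finite_subfamily (Kc n) (Uc n); exists V.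
exists V; split; first by move=> n; exact: (VP n).1.
left; apply: omega_cover_range => [n|F]; first exact: star_open.
move=> /(omega_cover_range_or_full (or_introl Kom)) [n FK].
by exists n; apply: subset_trans FK _; apply: star_subl; exact: (VP n).2.
Qed.

Lemma star_scheepers_scheepers (X : topologicalType) :
  paracompact X -> hausdorff_space X -> star_scheepers X -> scheepers X.
Proof.
move=> Xp Xh XS U Uc.
have /choice[W WP] : forall n, exists W : set (set X), open_cover W /\
    forall A, W A -> exists2 C, U n C & star A W `<=` C.
  by move=> n; have [W] := strong_star_refinement Xp Xh (Uc n); exists W.
have [V [VW /omega_cover_range_or_full VF]] := XS W (fun n => (WP n).1).
(* The choice is indexed by pairs since one set may belong to several [W n], with a different target
   cover for each [n]. *)
have /choice[c cP] : forall nA : nat * set X, exists C, W nA.1 nA.2 ->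
    U nA.1 C /\ star nA.2 (W nA.1) `<=` C.
  move=> [n A] /=; have [WA|nWA] := pselect (W n A); last by exists set0.
  by have [C UC AC] := (WP n).2 _ WA; exists C.
pose V' n := [set c (n, A) | A in V n].
have V'U n : V' n `<=` U n.
  by move=> _ [A /(VW n).2 WA <-]; have [] := cP (n, A) WA.
exists V'; split.
  by move=> n; split=> //; apply: finite_image; exact: (VW n).1.
left; apply: omega_cover_range => [n|F /VF[n FV]].
  exact: open_cover_bigcup_sub (Uc n) (V'U n).
(* A member [B] of [W n] that meets the union of [V n] meets some [A] in [V n], so it lies in the
   star of [A] and thus in [c (n, A)]. *)
exists n; apply: subset_trans FV _ => x [B [WB [z [[A VA Az] Bz]]] Bx].
exists (c (n, A)); first by exists A.
apply: (cP (n, A) ((VW n).2 _ VA)).2 => /=.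
by exists B => //; split=> //; exists z.
Qed.

Theorem proposition3p6 (X : topologicalType)
    (X_paracompact : paracompact X) (X_hausdorff : hausdorff_space X) :
  [<-> scheepers X;
       strongly_star_scheepers X;
       star_K_scheepers X;
       star_scheepers X].
Proof.
tfae.
- exact: scheepers_strongly_star.
- exact: strongly_star_star_K.
- exact: star_K_star_scheepers.
- exact: star_scheepers_scheepers.
Qed.
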